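(* Let the gPC basis $\phi_0,\dots,\phi_K$ satisfy properties (A1)--(A3), let $\hat h:\mathbb{H}^+\to\mathbb{R}^{K+1}$ be a (smooth) stochastic Galerkin formulation of a hesitation function and $\widehat{V_{\mathrm{eq}}}:\mathbb{H}^+\to\mathbb{R}^{K+1}$ a Galerkin formulation of an equilibrium velocity, and let $\tau>0$. Assume that the Jacobian of $\hat h$ has the form $$\widehat{h'}(\hat\rho):=\mathrm{D}_{\hat\rho}\hat h(\hat\rho)=V\,\mathcal{D}_{h'}(\hat\rho)\,V^{T}\qquad(\hat\rho\in\mathbb{H}^+)$$ with the constant matrix $V$ of eigenvectors from (A2) and $\mathcal{D}_{h'}(\hat\rho)$ diagonal with strictly positive diagonal entries. For $\hat\rho\in\mathbb{H}^+$ and $\hat z\in\mathbb{R}^{K+1}$ set $$\hat v(\hat\rho,\hat z)=\mathcal{P}^{-1}(\hat\rho)\hat z-\hat h(\hat\rho).$$ Then: (i) For smooth solutions the conservative and the non-conservative formulations are equivalent: if $\hat\rho(t,x)\in\mathbb{H}^+$ and $\hat z(t,x)\in\mathbb{R}^{K+1}$ are smooth functions and $\hat v=\hat v(\hat\rho,\hat z)$, then $(\hat\rho,\hat z)$ solves $$(\mathcal{C})\quad\begin{cases}\partial_t\hat\rho+\partial_x\big(\hat z-\mathcal{P}(\hat\rho)\hat h(\hat\rho)\big)=\vec 0,\\ \partial_t\hat z+\partial_x\big(\mathcal{P}(\hat z)\mathcal{P}^{-1}(\hat\rho)\hat z-\mathcal{P}(\hat z)\hat h(\hat\rho)\big)=\frac1\tau\,\mathcal{P}(\hat\rho)\big(\widehat{V_{\mathrm{eq}}}(\hat\rho)-\hat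 v(\hat\rho,\hat z)\big)\end{cases}$$ if and only if $(\hat\rho,\hat v)$ solves $$(\mathcal{N})\quad\begin{cases}\partial_t\hat\rho+\partial_x\big(\mathcal{P}(\hat\rho)\hat v\big)=\vec 0,\\ \partial_t\big(\hat v+\hat h(\hat\rho)\big)+\mathcal{P}(\hat v)\,\partial_x\big(\hat v+\hat h(\hat\rho)\big)=\frac1\tau\big(\widehat{V_{\mathrm{eq}}}(\hat\rho)-\hat v\big).\end{cases}$$ (ii) The characteristic speeds, i.e. the $2(K+1)$ eigenvalues (with multiplicity) of the Jacobian $\mathrm{D}_{\hat{\mathbf u}}\hat{\mathbf f}(\hat{\mathbf u})$, $\hat{\mathbf u}=(\hat\rho,\hat z)$, of the flux $$\hat{\mathbf f}(\hat{\mathbf u})=\begin{pmatrix}\hat z-\mathcal{P}(\hat\rho)\hat h(\hat\rho)\\ \mathcal{P}(\hat z)\mathcal{P}^{-1}(\hat\rho)\hat z-\mathcal{P}(\hat z)\hat h(\hat\rho)\end{pmatrix},$$ are the diagonal entries of the diagonal matrices $$\widehat{\lambda_1}(\hat\rho,\hat z)=\mathcal{D}\big(\hat v(\hat\rho,\hat z)\big)-\mathcal{D}_{h'}(\hat\rho)\,\mathcal{D}(\hat\rho)\qquad\text{and}\qquad\widehat{\lambda_2}(\hat\rho,\hat z)=\mathcal{D}\big(\hat v(\hat\rho,\hat z)\big).$$ (iii) The formulations $(\mathcal{N})$ and $(\mathcal{C})$ are strongly hyperbolic, in the sense that for all $\hat\rho\in\mathbb{H}^+$, $\hat z\in\mathbb{R}^{K+1}$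 the characteristic speeds are real and the Jacobian $\mathrm{D}_{\hat{\mathbf u}}\hat{\mathbf f}(\hat{\mathbf u})$ admits a complete set of eigenvectors.
   Context: Let $\xi$ be a random variable on a probability space with law $\mathbb{P}$, and let $\phi_0,\dots,\phi_K$ be real (piecewise polynomial) functions, orthonormal for $\langle f,g\rangle=\int f(\xi)g(\xi)\,d\mathbb{P}$, with all triple products integrable (a gPC basis). Define the symmetric matrices $\mathcal{M}_k=\big(\langle\phi_k,\phi_i\phi_j\rangle\big)_{i,j=0,\dots,K}$ and, for $\hat\alpha\in\mathbb{R}^{K+1}$, the linear operator $\mathcal{P}(\hat\alpha)=\sum_{k=0}^K\hat\alpha_k\mathcal{M}_k\in\mathbb{R}^{(K+1)\times(K+1)}$. The Galerkin product is $\hat\alpha\ast\hat\beta:=\mathcal{P}(\hat\alpha)\hat\beta$; it is symmetric. The following equivalent properties are assumed of the basis: (A1) the matrices $\mathcal{M}_\ell$ and $\mathcal{M}_k$ commute for all $\ell,k=0,\dots,K$; (A2) there is an eigenvalue decomposition $\mathcal{P}(\hat\alpha)=V\mathcal{D}(\hat\alpha)V^{T}$ for all $\hat\alpha\in\mathbb{R}^{K+1}$, with a constant orthogonal matrix $V$ (independent of $\hat\alpha$) and $\mathcal{D}(\hat\alpha)$ diagonal; (A3) $\mathcal{P}(\hat\alpha)$ and $\mathcal{P}(\hat\beta)$ commute for all $\hat\alpha,\hat\beta\in\mathbb{R}^{K+1}$. Throughout, $V$ and $\mathcal{D}(\cdot)$ are those of (A2), so $\mathcal{D}(\hat\alpha)=V^{T}\mathcal{P}(\hat\alpha)V$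 contains the eigenvalues of $\mathcal{P}(\hat\alpha)$. Standing assumption (no vacuum): $\mathcal{P}(\hat\rho)$ is strictly positive definite, i.e. $\hat\rho\in\mathbb{H}^+:=\{\hat\alpha\in\mathbb{R}^{K+1}:\mathcal{P}(\hat\alpha)\text{ is strictly positive definite}\}$ (an open convex cone). For fixed $K$, a ''stochastic Galerkin formulation'' $\hat h$ of a hesitation function $h$ (resp. $\widehat{V_{\mathrm{eq}}}$ of an equilibrium velocity $V_{\mathrm{eq}}$) is a given map $\mathbb{H}^+\to\mathbb{R}^{K+1}$ returning gPC modes approximating $h(\rho(\xi))$ (resp. $V_{\mathrm{eq}}(\rho(\xi))$); its consistency concerns only the limit $K\to\infty$ and imposes nothing for fixed $K$. $\mathrm{D}$ denotes the Jacobian matrix. Here $t>0$, $x\in\mathbb{R}$, and solutions are considered pointwise (classically). *)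

(* Defs.v *)
From HB Require Import structures.
From mathcomp Require Import all_boot all_order all_algebra.
From mathcomp Require Import all_classical all_reals all_analysis.
From mathcomp Require Import complex.

Set Implicit Arguments.
Unset Strict Implicit.
Unset Printing Implicit Defensive.

Import Order.TTheory GRing.Theory Num.Theory.
Import numFieldNormedType.Exports.

Local Open Scope classical_set_scope.
Local Open Scope ring_scope.

(* R is covered by finitely many intervals, possibly reduced to a point, on
   each of which f is a polynomial; the values at breakpoints are free. *)
Definition piecewise_polynomial (R : realType) (f : R -> R) : Prop :=
  exists s : seq (interval R * {poly R}),
    (forall x : R, exists2 Ip, Ip \in s & x \in Ip.1) /\
    (forall Ip, Ip \in s -> forall x : R, x \in Ip.1 -> f x = Ip.2.[x]).

Section gpc.
Context (R : realType) (d : measure_display) (Omega : measurableType d).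
Context (P : probability Omega R) (xi : {RV P >-> R}).

Definition inner (f g : R -> R) : R :=
  Rintegral (distribution P xi) setT (fun y => f y * g y).

Context (K : nat) (phi : 'I_K.+1 -> R -> R).

(* Square-integrability need not be required separately: Rintegral is 0 when
   the integral of a nonnegative function diverges, so inner (phi i) (phi i) = 1
   forces phi i to be in L^2. *)
Definition gpc_basis : Prop :=
  [/\ forall i, piecewise_polynomial (phi i),
      forall i j, inner (phi i) (phi j) = (i == j)%:R
    & forall i j k, (distribution P xi).-integrable setT
        (fun y => (phi i y * phi j y * phi k y)%:E)].

Definition galerkin_mx (k : 'I_K.+1) : 'M[R]_K.+1 :=
  \matrix_(i, j) inner (phi k) (fun y => phi i y * phi j y).

Definition galerkin_op (a : 'cV[R]_K.+1) : 'M[R]_K.+1 :=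
  \sum_(k < K.+1) a k 0 *: galerkin_mx k.

Definition propA1 : Prop :=
  forall l k, comm_mx (galerkin_mx l) (galerkin_mx k).

Definition propA2 (V : 'M[R]_K.+1) (D : 'cV[R]_K.+1 -> 'M[R]_K.+1) : Prop :=
  V^T *m V = 1%:M /\
  forall a, is_diag_mx (D a) /\ galerkin_op a = V *m D a *m V^T.

Definition propA3 : Prop :=
  forall a b, comm_mx (galerkin_op a) (galerkin_op b).

Definition pos_def (n : nat) (A : 'M[R]_n) : Prop :=
  A^T = A /\ forall x : 'cV[R]_n, x != 0 -> 0 < (x^T *m A *m x) 0 0.

Definition Hplus : set 'cV[R]_K.+1 := [set a | pos_def (galerkin_op a)].

End gpc.

Section calculus.
Context (R : realType).

(* To be used on open sets D only: the derivatives are taken in the ambient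
   space V. *)
Definition C1_on (V W : normedModType R) (D : set V) (f : V -> W) : Prop :=
  forall p, D p -> differentiable f p /\
    forall v : V, {for p, continuous (fun q => 'D_v f q)}.

(* The library's jacobian acts on row vectors from the right; this is the usual
   matrix of partial derivatives (d f_i / d x_j) of a map of column vectors. *)
Definition Jac (m n : nat) (f : 'cV[R]_n -> 'cV[R]_m) (p : 'cV[R]_n) :
    'M[R]_(m, n) :=
  \matrix_(i, j) ('D_(delta_mx j 0) f p) i 0.

Definition dt (W : normedModType R) (f : R -> R -> W) (t x : R) : W :=
  derive1 (fun s => f s x) t.

Definition dx (W : normedModType R) (f : R -> R -> W) (t x : R) : W :=
  derive1 (fun y => f t y) x.

Definition uncurry2 (W : Type) (f : R -> R -> W) (p : R * R) : W := f p.1 p.2.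

End calculus.

Section spectrum.
Context (R : realType).

Definition complexify (n : nat) (A : 'M[R]_n) : 'M[R[i]]_n :=
  map_mx (real_complex R) A.

(* s lists all complex eigenvalues of A with algebraic multiplicity. *)
Definition eigenvalues_with_mult (n : nat) (A : 'M[R]_n) (s : seq R[i]) : Prop :=
  char_poly (complexify A) = \prod_(z <- s) ('X - z%:P).

Definition diag_entries (n : nat) (A : 'M[R]_n) : seq R :=
  [seq A i i | i <- enum 'I_n].

(* The columns of the invertible W form a basis of right eigenvectors
   (mathcomp's eigenvalue and eigenspace are about row vectors). *)
Definition complete_eigenvectors (n : nat) (A : 'M[R]_n) : Prop :=
  exists2 W : 'M[R]_n, W \in unitmx &
    forall j, exists l : R, A *m col j W = l *: col j W.

Definition strongly_hyperbolic (n : nat) (A : 'M[R]_n) : Prop :=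
  (forall z : R[i], eigenvalue (complexify A) z -> complex.Im z = 0) /\
  complete_eigenvectors A.

End spectrum.

(* h and Veq stand for maps defined on the open cone Hplus; they are total here
   and their values outside Hplus play no role, as they are only evaluated and
   differentiated at points of Hplus. *)
Section arz.
Context (R : realType) (K : nat).
Context (Pop : 'cV[R]_K.+1 -> 'M[R]_K.+1) (h Veq : 'cV[R]_K.+1 -> 'cV[R]_K.+1).
Context (tau : R).

Definition velocity (rho z : 'cV[R]_K.+1) : 'cV[R]_K.+1 :=
  invmx (Pop rho) *m z - h rho.

Definition flux1 (rho z : 'cV[R]_K.+1) : 'cV[R]_K.+1 :=
  z - Pop rho *m h rho.

Definition flux2 (rho z : 'cV[R]_K.+1) : 'cV[R]_K.+1 :=
  Pop z *m invmx (Pop rho) *m z - Pop z *m h rho.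

Definition flux (u : 'cV[R]_(K.+1 + K.+1)) : 'cV[R]_(K.+1 + K.+1) :=
  col_mx (flux1 (usubmx u) (dsubmx u)) (flux2 (usubmx u) (dsubmx u)).

Definition solves_conservative (rho z : R -> R -> 'cV[R]_K.+1) : Prop :=
  forall t x : R, 0 < t ->
    dt rho t x + dx (fun s y => flux1 (rho s y) (z s y)) t x = 0 /\
    dt z t x + dx (fun s y => flux2 (rho s y) (z s y)) t x =
      tau^-1 *: (Pop (rho t x) *m
                 (Veq (rho t x) - velocity (rho t x) (z t x))).

Definition solves_nonconservative (rho v : R -> R -> 'cV[R]_K.+1) : Prop :=
  forall t x : R, 0 < t ->
    dt rho t x + dx (fun s y => Pop (rho s y) *m v s y) t x = 0 /\
    dt (fun s y => v s y + h (rho s y)) t x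
      + Pop (v t x) *m dx (fun s y => v s y + h (rho s y)) t x =
      tau^-1 *: (Veq (rho t x) - v t x).

End arz.

(* Main.v *)
(* By commutativity and [P(a) b = P(b) a], the Galerkin product is associative:
   [P(P(a) b) = P(a) P(b)], so gPC modes form a commutative algebra.  With
   [w = P(rho)^-1 z = v + h(rho)] the second flux is [P(m) w], [m = P(rho) v],
   and the conservative momentum balance reads
   [P(rho_t + m_x) w + P(rho) (w_t + P(v) w_x)]; the first term vanishes by
   conservation of mass and [P(rho)] is invertible.
   Write [A = P(w)], [B = P(rho)] and [G] for the Jacobian of [h]; they commute.
   The vectors [(r, A r)] and [(r, (A + B G) r)] span two invariant subspaces of
   the flux Jacobian, which acts on them through [r -> (P(v) - G B) r] and
   [r -> P(v) r]; they are complementary because [B G] is invertible.  Taking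
   [r] among the columns of [V] diagonalizes the Jacobian. *)
Require Import Defs.
From HB Require Import structures.
From mathcomp Require Import all_boot all_order all_algebra.
From mathcomp Require Import all_classical all_reals all_analysis.
From mathcomp Require Import complex.

Set Implicit Arguments.
Unset Strict Implicit.
Unset Printing Implicit Defensive.

Import Order.TTheory GRing.Theory Num.Theory.
Import numFieldNormedType.Exports.

Local Open Scope classical_set_scope.
Local Open Scope ring_scope.

(** * Differential calculus of matrix-valued maps *)

Section matrix_calculus.
Context (R : realType) (E : normedModType R).

(** Needed because [invmx] is defined by cases: its adjugate formula is available only near a point
    where the matrix is invertible. *)
Lemma near_eq_differentiable (W : normedModType R) (f g : E -> W) (x : E) :
  (\forall y \near x, f y = g y) -> differentiable f x -> differentiable g x.
Proof.
move=> fg df; have [cf ef] := (diff_locallyP _ _).1 df.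
(* The first-order expansion of [f] at [x] is also one of [g]; by uniqueness, ['d f x] is then the
   differential of [g]. *)
have eg : g \o shift x = cst (g x) + 'd f x +o_ 0 id.
  apply/eqaddoP => e e0; move/eqaddoP/(_ e e0) : ef => H.
  have fg0 : \forall y \near (0 : E), f (y + x) = g (y + x).
    by move: fg; rewrite (near_shift 0 x) /=; apply: filterS => y; rewrite subr0.
  near=> y.
  have -> : (g \o shift x - (cst (g x) + 'd f x)) y =
            (f \o shift x - (cst (f x) + 'd f x)) y.
    rewrite !fctE /=; congr (_ - (_ + _)); first by apply/esym; near: y.
    exact/esym/(nbhs_singleton fg).
  by near: y.
have dg := diff_unique cf eg.
by apply/diff_locallyP; rewrite dg.
Unshelve. all: by end_near. Qed.

Lemma differentiable_bigsum (I : Type) (s : seq I) (W : normedModType R)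
    (f : I -> E -> W) (x : E) :
  (forall i, differentiable (f i) x) ->
  differentiable (fun y => \sum_(i <- s) f i y) x.
Proof.
move=> df; elim: s => [|i s IH].
  by under eq_fun do rewrite big_nil; exact: differentiable_cst.
by under eq_fun do rewrite big_cons; exact: differentiableD (df i) IH.
Qed.

Lemma differentiable_bigprod (I : Type) (s : seq I) (f : I -> E -> R) (x : E) :
  (forall i, differentiable (f i) x) ->
  differentiable (fun y => \prod_(i <- s) f i y) x.
Proof.
move=> df; elim: s => [|i s IH].
  by under eq_fun do rewrite big_nil.
by under eq_fun do rewrite big_cons; exact: differentiableM.
Qed.

Lemma differentiable_entry m n (A : E -> 'M[R]_(m, n)) (x : E) i j :
  differentiable A x -> differentiable (fun y => A y i j) x.
Proof. by move=> dA; apply: differentiable_comp dA (differentiable_coord _ _ _). Qed.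

(** Continuity of [L] is not assumed: in finite dimension [L (A y)] is a finite combination of fixed
    vectors with the entries of [A y] as coefficients. *)
Lemma differentiable_linear_comp m n (W : normedModType R)
    (L : {linear 'M[R]_(m, n) -> W}) (A : E -> 'M[R]_(m, n)) (x : E) :
  differentiable A x -> differentiable (fun y => L (A y)) x.
Proof.
move=> dA; have -> : (fun y => L (A y)) =
    fun y => \sum_i \sum_j A y i j *: L (delta_mx i j).
  apply/funext => y; rewrite {1}(matrix_sum_delta (A y)) linear_sum.
  apply: eq_bigr => i _; rewrite linear_sum; apply: eq_bigr => j _.
  by rewrite linearZ.
apply: differentiable_bigsum => i; apply: differentiable_bigsum => j.
exact/differentiableZl/differentiable_entry.
Qed.

Lemma differentiable_mx m n (A : E -> 'M[R]_(m, n)) (x : E) :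
  (forall i j, differentiable (fun y => A y i j) x) -> differentiable A x.
Proof.
move=> dA.
have -> : A = fun y => \sum_i \sum_j A y i j *: delta_mx i j.
  by apply/funext => y; exact: matrix_sum_delta.
apply: differentiable_bigsum => i; apply: differentiable_bigsum => j.
exact: differentiableZl.
Qed.

Lemma differentiable_mulmx m n p (A : E -> 'M[R]_(m, n))
    (B : E -> 'M[R]_(n, p)) (x : E) :
  differentiable A x -> differentiable B x ->
  differentiable (fun y => A y *m B y) x.
Proof.
move=> dA dB; apply: differentiable_mx => i j.
under eq_fun do rewrite mxE.
by apply: differentiable_bigsum => k; apply: differentiableM;
  exact: differentiable_entry.
Qed.

Lemma derive_mulmx m n p (A : E -> 'M[R]_(m, n)) (B : E -> 'M[R]_(n, p))
    (x v : E) :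
  differentiable A x -> differentiable B x ->
  'D_v (fun y => A y *m B y) x = 'D_v A x *m B x + A x *m 'D_v B x.
Proof.
move=> dA dB; have dAB := differentiable_mulmx dA dB.
rewrite !derive_mx; try exact: diff_derivable.
apply/matrixP => i j; rewrite !mxE.
have -> : (fun y => (A y *m B y) i j) =
    \sum_k ((fun y => A y i k) * (fun y => B y k j)).
  by apply/funext => y; rewrite mxE fct_sumE.
have dAe k := @diff_derivable _ _ _ _ x v (differentiable_entry i k dA).
have dBe k := @diff_derivable _ _ _ _ x v (differentiable_entry k j dB).
rewrite derive_sum; last by move=> k; exact: derivableM.
rewrite -big_split; apply: eq_bigr => k _ /=.
by rewrite deriveM // !mxE addrC; congr (_ + _); rewrite /GRing.scale /= mulrC.
Qed.

Lemma differentiable_det n (A : E -> 'M[R]_n) (x : E) :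
  differentiable A x -> differentiable (fun y => \det (A y)) x.
Proof.
move=> dA; apply: differentiable_bigsum => s.
apply: differentiableM; first exact: differentiable_cst.
by apply: differentiable_bigprod => i; exact: differentiable_entry.
Qed.

Lemma differentiable_adjugate n (A : E -> 'M[R]_n) (x : E) :
  differentiable A x -> differentiable (fun y => \adj (A y)) x.
Proof.
move=> dA; apply: differentiable_mx => i j.
under eq_fun do rewrite mxE.
apply: differentiableM; first exact: differentiable_cst.
apply: differentiable_det; apply: differentiable_mx => k l.
by under eq_fun do rewrite !mxE; exact: differentiable_entry.
Qed.

Lemma near_unitmx n (A : E -> 'M[R]_n) (x : E) :
  differentiable A x -> A x \in unitmx -> \forall y \near x, A y \in unitmx.
Proof.
move=> dA; rewrite unitmxE unitfE => Ax.
have /differentiable_continuous cdet := differentiable_det dA.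
by apply: filterS (cvgr_neq0 _ cdet Ax) => y; rewrite unitmxE unitfE.
Qed.

Lemma differentiable_invmx n (A : E -> 'M[R]_n) (x : E) :
  differentiable A x -> A x \in unitmx ->
  differentiable (fun y => invmx (A y)) x.
Proof.
move=> dA Ax.
(* Cramer's rule near [x]: the determinant stays nonzero there, and the right-hand side is
   differentiable entry by entry. *)
apply: (@near_eq_differentiable _ (fun y => (\det (A y))^-1 *: \adj (A y))).
  have := near_unitmx dA Ax; apply: filterS => y Ay.
  by rewrite /invmx Ay.
apply: differentiable_mx => i j; under eq_fun do rewrite mxE.
apply: differentiableM.
  by apply: differentiableV;
    [exact: differentiable_det|rewrite -unitfE -unitmxE].
exact/differentiable_entry/differentiable_adjugate.
Qed.

End matrix_calculus.

Lemma derive_linear_comp (R : realType) (E W : normedModType R) m n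
    (L : {linear 'M[R]_(m, n) -> W}) (A : E -> 'M[R]_(m, n)) (x v : E) :
  differentiable A x -> 'D_v (fun y => L (A y)) x = L ('D_v A x).
Proof.
(* Taking [A] to be the identity shows that [L] is differentiable, hence continuous, which
   [diff_lin] requires. *)
move=> dA; have dL M : differentiable L M.
  exact: (@differentiable_linear_comp _ _ _ _ _ L id).
rewrite !deriveE //; last exact: differentiable_comp.
rewrite diff_comp //= diff_lin // => M; exact: differentiable_continuous.
Qed.

(** Differentiability makes the directional derivative linear in the direction, so its values on the
    canonical basis, the columns of [Jac], determine it. *)
Lemma Jac_mulmx (R : realType) m n (f : 'cV[R]_n -> 'cV[R]_m) (p v : 'cV[R]_n) :
  differentiable f p -> Jac f p *m v = 'D_v f p.
Proof.
move=> df; rewrite deriveE // [in RHS](matrix_sum_delta v) linear_sum.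
apply/matrixP => i j; rewrite mxE summxE; apply: eq_bigr => k _.
by rewrite big_ord1 linearZ !mxE ord1 /= -deriveE // mulrC.
Qed.

(** * Linear algebra: invertibility, similarity and spectra *)

Lemma eq_mulmx_col (R : nzSemiRingType) m n (A B : 'M[R]_(m, n)) :
  (forall x : 'cV_n, A *m x = B *m x) -> A = B.
Proof.
move=> AB; apply/matrixP => i j.
by have /matrixP/(_ i 0) := AB (delta_mx j 0); rewrite -!colE !mxE.
Qed.

Lemma pos_def_unitmx (R : realType) n (A : 'M[R]_n) :
  pos_def A -> A \in unitmx.
Proof.
case=> symA posA; rewrite unitmxE unitfE; apply/negP => /det0P[v v0 vA].
have := posA v^T; rewrite trmxK vA mul0mx mxE ltxx.
by rewrite -(inj_eq trmx_inj) trmxK trmx0 => /(_ v0).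
Qed.

Lemma diag_mx_unitmx (R : realType) n (A : 'M[R]_n) :
  is_diag_mx A -> (forall i, 0 < A i i) -> A \in unitmx.
Proof.
move=> dA posA; rewrite unitmxE unitfE det_trig ?is_diag_mx_is_trig //.
by apply/prodf_neq0 => i _; rewrite gt_eqF.
Qed.

Lemma mulmx_diagC (R : comNzRingType) n (A B : 'M[R]_n) :
  is_diag_mx A -> is_diag_mx B -> A *m B = B *m A.
Proof.
move=> /diag_mxP[a ->] /diag_mxP[b ->]; exact: diag_mxC.
Qed.

(** No inverse of [U] is formed: both characteristic determinants agree after multiplication by the
    nonzero constant polynomial [\det Up], which cancels in an integral domain. *)
Lemma char_poly_similar (R : idomainType) n (A B U : 'M[R]_n) :
  \det U != 0 -> A *m U = U *m B -> char_poly A = char_poly B.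
Proof.
move=> U0 AU; pose Up := map_mx (@polyC R) U.
have Up0 : \det Up != 0 by rewrite det_map_mx polyC_eq0.
apply: (mulIf Up0); rewrite /char_poly -det_mulmx [RHS]mulrC -det_mulmx.
congr (\det _); rewrite /char_poly_mx mulmxBl mulmxBr -!map_mxM AU.
by rewrite scalar_mxC.
Qed.

Lemma char_poly_diag_block (R : comNzRingType) m n (A : 'M[R]_m) (B : 'M[R]_n) :
  is_diag_mx A -> is_diag_mx B ->
  char_poly (block_mx A 0 0 B) =
  (\prod_i ('X - (A i i)%:P)) * \prod_i ('X - (B i i)%:P).
Proof.
move=> dA dB; rewrite char_poly_trig; last first.
  by rewrite is_trig_block_mx // eqxx !is_diag_mx_is_trig.
rewrite big_split_ord /=; congr (_ * _); apply: eq_bigr => i _.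
  by rewrite block_mxEul.
by rewrite block_mxEdr.
Qed.

Lemma complete_eigenvectors_diag (R : realType) n (A L U : 'M[R]_n) :
  U \in unitmx -> is_diag_mx L -> A *m U = U *m L -> complete_eigenvectors A.
Proof.
move=> uU /diag_mxP[l ->] AU; exists U => // j; exists (l 0 j).
rewrite !colE mulmxA AU -mulmxA -!colE.
apply/matrixP => i k; rewrite mxE [RHS]mxE (bigD1 j) //= big1 => [|a aj].
  by rewrite !mxE eqxx mulr1n addr0 mulrC.
by rewrite !mxE (negPf aj) mulr0.
Qed.

(** * The Galerkin operator of a basis: linearity and symmetry of the product *)

Section galerkin_linear.
Context (R : realType) (d : measure_display) (Omega : measurableType d).
Context (P : probability Omega R) (xi : {RV P >-> R}) (K : nat).
Context (phi : 'I_K.+1 -> R -> R).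

Lemma galerkin_op_is_linear : linear (galerkin_op xi phi).
Proof.
move=> c a b; rewrite /galerkin_op scaler_sumr -big_split.
by apply: eq_bigr => k _; rewrite !mxE scalerDl scalerA.
Qed.

HB.instance Definition _ := GRing.isLinear.Build R 'cV[R]_K.+1 'M[R]_K.+1 _
  (galerkin_op xi phi) galerkin_op_is_linear.

Lemma galerkin_mx_swap i j k :
  galerkin_mx xi phi k i j = galerkin_mx xi phi j i k.
Proof.
rewrite !mxE /inner; congr (Rintegral _ _ _); apply/funext => y.
by rewrite mulrC -mulrA mulrCA.
Qed.

(** Both sides are double sums of triple integrals, which are symmetric in all three indices;
    exchanging the two summation indices swaps [a] and [b]. *)
Lemma galerkin_prodC (a b : 'cV[R]_K.+1) :
  galerkin_op xi phi a *m b = galerkin_op xi phi b *m a.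
Proof.
apply/matrixP => i j; rewrite !mxE.
under eq_bigr do rewrite summxE mulr_suml.
under [RHS]eq_bigr do rewrite summxE mulr_suml.
rewrite exchange_big /=; apply: eq_bigr => k _; apply: eq_bigr => l _.
rewrite mxE [in RHS]mxE [in RHS]galerkin_mx_swap !ord1.
by rewrite mulrC [a k 0 * _]mulrC mulrA.
Qed.

End galerkin_linear.

(** * Galerkin products for an abstract linear [Pop], symmetric and commuting *)

Section galerkin_algebra.
Context (R : realType) (n : nat) (Pop : {linear 'cV[R]_n -> 'M[R]_n}).
Hypothesis PopC : forall a b, Pop a *m b = Pop b *m a.
Hypothesis Pop_comm : forall a b, Pop a *m Pop b = Pop b *m Pop a.

(** Applied to [x], the left side is [Pop x *m (Pop a *m b)]; commuting the two operators and
    swapping [x] with [b] gives the right side. *)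
Lemma Pop_mulmx a b : Pop (Pop a *m b) = Pop a *m Pop b.
Proof.
apply: eq_mulmx_col => x.
by rewrite (PopC _ x) mulmxA -Pop_comm -!mulmxA (PopC x b).
Qed.

Section along.
Context (E : normedModType R) (a b : E -> 'cV[R]_n) (x : E).
Hypotheses (da : differentiable a x) (db : differentiable b x).

Lemma differentiable_galerkin_prod : differentiable (fun y => Pop (a y) *m b y) x.
Proof. exact/differentiable_mulmx/db/differentiable_linear_comp. Qed.

Lemma derive_galerkin_prod v :
  'D_v (fun y => Pop (a y) *m b y) x =
  Pop ('D_v a x) *m b x + Pop (a x) *m 'D_v b x.
Proof.
rewrite derive_mulmx ?derive_linear_comp //.
exact: differentiable_linear_comp.
Qed.

Hypothesis ua : Pop (a x) \in unitmx.

Lemma differentiable_galerkin_quot :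
  differentiable (fun y => invmx (Pop (a y)) *m b y) x.
Proof.
apply/differentiable_mulmx/db/differentiable_invmx/ua.
exact: differentiable_linear_comp.
Qed.

End along.

(* Differentiates the identity [Pop a *m w = b], valid near [x], so that the
   derivative of a matrix inverse is never computed. *)
Lemma derive_galerkin_quot (E : normedModType R) (a b : E -> 'cV[R]_n) (x v : E)
    (w := fun y => invmx (Pop (a y)) *m b y) :
  differentiable a x -> differentiable b x -> Pop (a x) \in unitmx ->
  'D_v b x = Pop ('D_v a x) *m w x + Pop (a x) *m 'D_v w x.
Proof.
move=> da db ua; have dw := differentiable_galerkin_quot da db ua.
rewrite -derive_galerkin_prod //; apply: near_eq_derive.
have := near_unitmx (differentiable_linear_comp Pop da) ua.
by apply: filterS => y uy; rewrite /w mulKVmx.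
Qed.

End galerkin_algebra.

(** * The traffic system: equivalence of the two formulations *)

Section galerkin_arz.
Context (R : realType) (K : nat) (Pop : {linear 'cV[R]_K.+1 -> 'M[R]_K.+1}).
Context (h : 'cV[R]_K.+1 -> 'cV[R]_K.+1).
Hypothesis PopC : forall a b, Pop a *m b = Pop b *m a.
Hypothesis Pop_comm : forall a b, Pop a *m Pop b = Pop b *m Pop a.

Lemma flux1E rho z :
  Pop rho \in unitmx -> flux1 Pop h rho z = Pop rho *m velocity Pop h rho z.
Proof. by move=> ur; rewrite /flux1 /velocity mulmxBr mulKVmx. Qed.

Lemma flux2E rho z :
  Pop rho \in unitmx ->
  flux2 Pop h rho z =
  Pop (Pop rho *m velocity Pop h rho z) *m (invmx (Pop rho) *m z).
Proof.
move=> ur; rewrite Pop_mulmx // -Pop_comm -mulmxA mulKVmx // PopC.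
by rewrite /flux2 /velocity mulmxBr mulmxA.
Qed.

(** Regroups the product rules for [z] and the second flux, with [a], [b] the time derivatives of
    [rho], [w] and [c], [e] the space derivatives of [m], [w]. The sum [a + c] is the left side of
    the mass balance. *)
Lemma Pop_factor (a b c e r v w : 'cV[R]_K.+1) :
  Pop a *m w + Pop r *m b + (Pop c *m w + Pop (Pop r *m v) *m e) =
  Pop (a + c) *m w + Pop r *m (b + Pop v *m e).
Proof. by rewrite Pop_mulmx // linearD mulmxDl mulmxDr mulmxA addrACA. Qed.

Lemma conservative_nonconservative_equiv (H : set 'cV[R]_K.+1)
    (Veq : 'cV[R]_K.+1 -> 'cV[R]_K.+1) (tau : R)
    (rho z : R -> R -> 'cV[R]_K.+1) :
  (forall a, H a -> Pop a \in unitmx) ->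
  (forall a, H a -> differentiable h a) ->
  (forall p : R * R, 0 < p.1 -> differentiable (uncurry2 rho) p) ->
  (forall p : R * R, 0 < p.1 -> differentiable (uncurry2 z) p) ->
  (forall t x : R, 0 < t -> H (rho t x)) ->
  solves_conservative Pop h Veq tau rho z <->
  solves_nonconservative Pop h Veq tau rho
    (fun t x => velocity Pop h (rho t x) (z t x)).
Proof.
move=> uH dh drho dz Hrho.
pose w t x := invmx (Pop (rho t x)) *m z t x.
pose v t x := velocity Pop h (rho t x) (z t x).
pose m t x := Pop (rho t x) *m v t x.
have uP t x : 0 < t -> Pop (rho t x) \in unitmx by move=> t0; exact/uH/Hrho.
have d_t (f : R -> R -> 'cV[R]_K.+1) t x : differentiable (uncurry2 f) (t, x) ->
    differentiable (fun s => f s x) t.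
  move=> df; apply: (@differentiable_comp _ _ _ _ (fun s : R => (s, x))
    (uncurry2 f)) => //.
have d_x (f : R -> R -> 'cV[R]_K.+1) t x : differentiable (uncurry2 f) (t, x) ->
    differentiable (fun y => f t y) x.
  move=> df; apply: (@differentiable_comp _ _ _ _ (fun y : R => (t, y))
    (uncurry2 f)) => //.
have wE : (fun t x => v t x + h (rho t x)) = w.
  by apply/funext => t; apply/funext => x; rewrite /v /velocity subrK.
have flux1_m t x : 0 < t -> dx (fun s y => flux1 Pop h (rho s y) (z s y)) t x =
    dx m t x.
  (* At a fixed positive time the state lies in [H] for every [y], so the two functions of [y] are
     equal outright. *)
  move=> t0; have flux1_mt : (fun y => flux1 Pop h (rho t y) (z t y)) = m t.
    by apply/funext => y; exact/flux1E/uP.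
  by rewrite /dx flux1_mt.
have balance t x : 0 < t ->
    dt z t x + dx (fun s y => flux2 Pop h (rho s y) (z s y)) t x =
    Pop (dt rho t x + dx m t x) *m w t x +
    Pop (rho t x) *m (dt w t x + Pop (v t x) *m dx w t x).
  move=> t0; have ur := uP t x t0.
  have rhot := d_t _ t x (drho (t, x) t0); have zt := d_t _ t x (dz (t, x) t0).
  have rhox := d_x _ t x (drho (t, x) t0); have zx := d_x _ t x (dz (t, x) t0).
  have wx := differentiable_galerkin_quot rhox zx ur.
  have vx : differentiable (fun y => v t y) x.
    apply: differentiableB => //; apply: differentiable_comp => //.
    exact/dh/Hrho.
  have mx := differentiable_galerkin_prod Pop rhox vx.
  (* In time, invertibility is known only for positive values, not on the whole line;
     [derive_galerkin_quot] asks for it at [t] alone. *)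
  have -> : dt z t x = Pop (dt rho t x) *m w t x + Pop (rho t x) *m dt w t x.
    by rewrite /dt !derive1E (derive_galerkin_quot (1 : R) rhot zt ur).
  have -> : dx (fun s y => flux2 Pop h (rho s y) (z s y)) t x =
      Pop (dx m t x) *m w t x + Pop (m t x) *m dx w t x.
    have flux2_mw : (fun y => flux2 Pop h (rho t y) (z t y)) =
        (fun y => Pop (m t y) *m w t y).
      by apply/funext => y; exact/flux2E/uP.
    by rewrite /dx flux2_mw !derive1E (derive_galerkin_prod Pop mx wx).
  exact: Pop_factor.
(* The invertible factor [Pop (rho t x)] cancels from the source term. *)
have sourceE t x a : 0 < t ->
    Pop (rho t x) *m a =
      tau^-1 *: (Pop (rho t x) *m (Veq (rho t x) - v t x)) <->
    a = tau^-1 *: (Veq (rho t x) - v t x).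
  move=> t0; rewrite scalemxAr; split=> [|-> //].
  by move/(congr1 (mulmx (invmx (Pop (rho t x))))); rewrite !mulKmx ?uP.
(* In both directions the mass equation annihilates the first term of [balance]. *)
split=> sol t x t0; have [mass mom] := sol t x t0.
- rewrite flux1_m // in mass; split; first exact: mass.
  rewrite [fun _ _ => _ + _]wE; apply/sourceE => //.
  by move: mom; rewrite balance // mass linear0 mul0mx add0r.
- rewrite [fun _ _ => _ + _]wE in mom; split; first by rewrite flux1_m.
  rewrite balance // [dt rho t x + _]mass linear0 mul0mx add0r.
  exact/sourceE.
Qed.

(** * Directional derivatives of the flux *)

Section flux_derivative.
Context (rho z : 'cV[R]_K.+1).
Hypotheses (ur : Pop rho \in unitmx) (dh : differentiable h rho).

Let p := col_mx rho z.
Let rho_ (u : 'cV[R]_(K.+1 + K.+1)) : 'cV[R]_K.+1 := usubmx u.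
Let z_ (u : 'cV[R]_(K.+1 + K.+1)) : 'cV[R]_K.+1 := dsubmx u.
Let w_ u := invmx (Pop (rho_ u)) *m z_ u.
Let h_ u := h (rho_ u).
Let v_ u := w_ u - h_ u.

(** Writing the stacked vector as a sum of two constant injections reduces its differentiation to
    that of linear images. *)
Let flux_split : flux Pop h = fun u =>
  col_mx 1%:M 0 *m (z_ u - Pop (rho_ u) *m h_ u) +
  col_mx 0 1%:M *m (Pop (z_ u) *m v_ u).
Proof.
apply/funext => u; rewrite !mul_col_mx !mul1mx !mul0mx add_col_mx addr0 add0r.
by rewrite /flux /flux1 /flux2 /v_ /w_ mulmxBr mulmxA.
Qed.

Let rho_p : rho_ p = rho. Proof. exact: col_mxKu. Qed.
Let z_p : z_ p = z. Proof. exact: col_mxKd. Qed.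

Let drho : differentiable rho_ p.
Proof. exact: (@differentiable_linear_comp _ _ _ _ _ usubmx id). Qed.

Let dz : differentiable z_ p.
Proof. exact: (@differentiable_linear_comp _ _ _ _ _ dsubmx id). Qed.

Let d_h : differentiable h_ p.
Proof. by apply: differentiable_comp => //; rewrite rho_p. Qed.

Let dw : differentiable w_ p.
Proof. by apply: differentiable_galerkin_quot => //; rewrite rho_p. Qed.

Let dv : differentiable v_ p.
Proof. exact: differentiableB. Qed.

Let dflux1 : differentiable (fun u => z_ u - Pop (rho_ u) *m h_ u) p.
Proof. exact/differentiableB/differentiable_galerkin_prod. Qed.

Let dflux2 : differentiable (fun u => Pop (z_ u) *m v_ u) p.
Proof. exact/differentiable_galerkin_prod. Qed.

Lemma differentiable_flux : differentiable (flux Pop h) p.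
Proof.
rewrite flux_split.
by apply: differentiableD;
  apply: (@differentiable_linear_comp _ _ _ _ _ (mulmx _)).
Qed.

(** The direction is described by [r] and the derivative [w'] of [w] rather than by [s]:
    differentiating [Pop rho *m w = z] gives the relation [sE], and the derivative of the inverse
    never appears. *)
Lemma derive_flux r s w' :
  s = Pop r *m (invmx (Pop rho) *m z) + Pop rho *m w' ->
  'D_(col_mx r s) (flux Pop h) p =
  col_mx (s - (Pop r *m h rho + Pop rho *m 'D_r h rho))
         (Pop s *m velocity Pop h rho z + Pop z *m (w' - 'D_r h rho)).
Proof.
move=> sE; set e := col_mx r s.
have rho' : 'D_e rho_ p = r.
  rewrite (@derive_linear_comp _ _ _ _ _ usubmx id) // derive_id.
  exact: col_mxKu.
have z' : 'D_e z_ p = s.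
  rewrite (@derive_linear_comp _ _ _ _ _ dsubmx id) // derive_id.
  exact: col_mxKd.
have h' : 'D_e h_ p = 'D_r h rho.
  rewrite !deriveE // (@diff_comp _ _ _ _ rho_ h) ?rho_p //=.
  by rewrite -(deriveE _ drho) rho'.
have wp : w_ p = invmx (Pop rho) *m z by rewrite /w_ rho_p z_p.
have w'E : 'D_e w_ p = w'.
  have urp : Pop (rho_ p) \in unitmx by rewrite rho_p.
  have quot : 'D_e z_ p = Pop ('D_e rho_ p) *m w_ p + Pop (rho_ p) *m 'D_e w_ p.
    exact: derive_galerkin_quot.
  move: quot; rewrite z' rho' wp rho_p sE => /addrI.
  (* The two expressions for [s] differ only in the vector under [Pop rho], which is cancelled. *)
  move/(congr1 (mulmx (invmx (Pop rho)))).
  by rewrite !mulKmx.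
have v' : 'D_e v_ p = w' - 'D_r h rho.
  by rewrite -w'E -h'; apply: deriveB; exact: diff_derivable.
have flux1' : 'D_e (fun u => z_ u - Pop (rho_ u) *m h_ u) p =
    s - (Pop r *m h rho + Pop rho *m 'D_r h rho).
  have -> : 'D_e (fun u => z_ u - Pop (rho_ u) *m h_ u) p =
      'D_e z_ p - 'D_e (fun u => Pop (rho_ u) *m h_ u) p.
    by apply: deriveB; apply: diff_derivable; first exact: dz;
       exact: differentiable_galerkin_prod.
  by rewrite (derive_galerkin_prod Pop drho d_h) z' rho' h' /h_ rho_p.
have flux2' : 'D_e (fun u => Pop (z_ u) *m v_ u) p =
    Pop s *m velocity Pop h rho z + Pop z *m (w' - 'D_r h rho).
  by rewrite (derive_galerkin_prod Pop dz dv) z' v' z_p /v_ wp /h_ rho_p.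
have d_lift (C : 'M[R]_(K.+1 + K.+1, K.+1))
    (f : 'cV[R]_(K.+1 + K.+1) -> 'cV[R]_K.+1) :
    differentiable f p ->
    differentiable (fun u => C *m f u) p /\
    'D_e (fun u => C *m f u) p = C *m 'D_e f p.
  by split; [exact: (@differentiable_linear_comp _ _ _ _ _ (mulmx C))|
             exact: (@derive_linear_comp _ _ _ _ _ (mulmx C))].
have [d1 D1] := d_lift (col_mx 1%:M 0) _ dflux1.
have [d2 D2] := d_lift (col_mx 0 1%:M) _ dflux2.
rewrite flux_split deriveD; try exact: diff_derivable.
rewrite D1 D2 flux1' flux2' !mul_col_mx !mul1mx !mul0mx add_col_mx.
by rewrite addr0 add0r.
Qed.

End flux_derivative.

(** * Block diagonalization of the flux Jacobian *)

Lemma Jac_flux_mulmx rho z :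
  Pop rho \in unitmx -> differentiable h rho ->
  let A := Pop (invmx (Pop rho) *m z) in
  let B := Pop rho in
  let G := Jac h rho in
  (forall a, G *m Pop a = Pop a *m G) ->
  Jac (flux Pop h) (col_mx rho z) *m block_mx 1%:M 1%:M A (A + B *m G) =
  block_mx 1%:M 1%:M A (A + B *m G) *m
  block_mx (Pop (velocity Pop h rho z) - G *m B) 0 0 (Pop (velocity Pop h rho z)).
Proof.
move=> ur dh A B G GC; set v := velocity Pop h rho z.
have zE : Pop z = B *m A by rewrite -Pop_mulmx // mulKVmx.
have vE : Pop v = A - Pop (h rho) by rewrite -linearB.
have dhE r : 'D_r h rho = G *m r by rewrite Jac_mulmx.
have J := Jac_mulmx _ (differentiable_flux z ur dh).
rewrite mulmx_block !mul1mx !mulmx0 !addr0 !add0r.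
apply: eq_mulmx_col => x; rewrite -[x]vsubmxK.
move: (usubmx x) (dsubmx x) => r s.
rewrite -mulmxA !mul_block_col !mul1mx.
have -> : col_mx (r + s) (A *m r + (A + B *m G) *m s) =
   col_mx r (A *m r) + col_mx s ((A + B *m G) *m s) by rewrite add_col_mx.
rewrite mulmxDr !J.
(* Directions of the first block column keep [w] fixed to first order: [w'] is 0. *)
have /(derive_flux ur dh) -> : A *m r =
    Pop r *m (invmx (Pop rho) *m z) + Pop rho *m 0.
  by rewrite mulmx0 addr0 PopC.
(* Directions of the second block column have [w' = G *m s], the derivative of [h], so the velocity
   is fixed to first order. *)
have /(derive_flux ur dh) -> : (A + B *m G) *m s =
    Pop s *m (invmx (Pop rho) *m z) + Pop rho *m (G *m s).
  by rewrite mulmxDl PopC -(mulmxA B).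
rewrite -/v -/B !dhE subrr mulmx0 addr0 sub0r mulmxN add_col_mx.
rewrite !(PopC _ (h rho)) !(PopC _ v) !mulmxA -!mulmxDl -!mulmxBl.
(* [e1] and [e2] match the upper components on the two subspaces, [e3] and [e4] the lower ones. *)
have e1 : A - (Pop (h rho) + B *m G) = Pop v - G *m B.
  by rewrite vE GC opprD addrA.
have e2 : A + B *m G - (Pop (h rho) + B *m G) = Pop v.
  by rewrite vE opprD addrACA subrr addr0.
have e3 : Pop v *m A - Pop z *m G = A *m (Pop v - G *m B).
  by rewrite mulmxBr Pop_comm zE (Pop_comm rho) -mulmxA -GC.
have e4 : Pop v *m (A + B *m G) = (A + B *m G) *m Pop v.
  by rewrite mulmxDr mulmxDl mulmxA !(Pop_comm v) -!mulmxA GC.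
by rewrite e1 e2 e3 e4.
Qed.

Lemma Jac_flux_diagonalization (V : 'M[R]_K.+1) (D : 'cV[R]_K.+1 -> 'M[R]_K.+1)
    (Dh : 'M[R]_K.+1) rho z :
  V^T *m V = 1%:M ->
  (forall a, is_diag_mx (D a) /\ Pop a = V *m D a *m V^T) ->
  Pop rho \in unitmx -> differentiable h rho ->
  Jac h rho = V *m Dh *m V^T -> is_diag_mx Dh -> Dh \in unitmx ->
  let v := velocity Pop h rho z in
  exists2 U, U \in unitmx &
    Jac (flux Pop h) (col_mx rho z) *m U =
    U *m block_mx (D v - Dh *m D rho) 0 0 (D v).
Proof.
move=> VV DP ur dh hG dDh uDh v.
have conjM X Y : (V *m X *m V^T) *m (V *m Y *m V^T) = V *m (X *m Y) *m V^T.
  by rewrite !mulmxA -[_ *m V^T *m V]mulmxA VV mulmx1.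
have [uVT uV] := mulmx1_unit VV.
(* The Jacobian of [h] and every [Pop a] are diagonal in the same basis [V], hence commute. *)
have GC a : Jac h rho *m Pop a = Pop a *m Jac h rho.
  have [da ->] := DP a; rewrite hG !conjM; congr (_ *m _ *m _).
  exact: mulmx_diagC.
have uG : Jac h rho \in unitmx by rewrite hG !unitmx_mul uV uDh uVT.
pose A := Pop (invmx (Pop rho) *m z); pose BG := Pop rho *m Jac h rho.
(* The first factor separates the two invariant subspaces; the second takes the columns of [V] as
   basis of each. *)
exists (block_mx 1%:M 1%:M A (A + BG) *m block_mx V 0 0 V).
  (* Block elimination leaves the determinant of [BG], a product of two invertible matrices. *)
  have -> : block_mx 1%:M 1%:M A (A + BG) =
      block_mx 1%:M 0 A 1%:M *m block_mx 1%:M 1%:M 0 BG.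
    by rewrite mulmx_block !mul1mx !mulmx1 !mul0mx !addr0.
  rewrite !unitmx_mul !unitmxE det_lblock !det_ublock !det1 !mul1r.
  by rewrite unitr1 unitrM -!unitmxE /BG unitmx_mul ur uG uV.
rewrite mulmxA Jac_flux_mulmx // -!mulmxA; congr (_ *m _).
have lift X Y : V *m X *m V^T = Y -> Y *m V = V *m X.
  by move=> <-; rewrite -mulmxA VV mulmx1.
rewrite !mulmx_block !mul0mx !mulmx0 !addr0 !add0r.
congr block_mx; apply: lift; last by rewrite -(DP _).2.
by rewrite mulmxBr mulmxBl -conjM -hG -!(DP _).2.
Qed.

End galerkin_arz.

(** * From the diagonalization to the spectrum and hyperbolicity *)

Section block_diagonalized.
Context (R : realType) (n : nat) (J U : 'M[R]_(n + n)) (L1 L2 : 'M[R]_n).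
Hypotheses (uU : U \in unitmx) (dL1 : is_diag_mx L1) (dL2 : is_diag_mx L2).
Hypothesis JU : J *m U = U *m block_mx L1 0 0 L2.

Lemma eigenvalues_with_mult_block :
  eigenvalues_with_mult J
    [seq real_complex R l | l <- diag_entries L1 ++ diag_entries L2].
Proof.
(* The characteristic polynomial is factored over the reals and then mapped to the complex
   numbers. *)
rewrite /eigenvalues_with_mult /complexify -map_char_poly.
rewrite (char_poly_similar _ JU); last by rewrite -unitfE -unitmxE.
rewrite char_poly_diag_block // rmorphM !rmorph_prod big_map big_cat /= !big_map.
rewrite -!enumT !big_enum; congr (_ * _); apply: eq_big => // i _;
  by rewrite rmorphB /= map_polyX map_polyC.
Qed.

Lemma strongly_hyperbolic_block : strongly_hyperbolic J.
Proof.
split=> [x|]; last first.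
  by apply: complete_eigenvectors_diag uU _ JU;
    rewrite is_diag_block_mx // !eqxx dL1.
(* A complex eigenvalue is a root of a product of linear factors with real roots, so it is one of
   those reals. *)
rewrite eigenvalue_root_char eigenvalues_with_mult_block root_prod_XsubC.
by case/mapP => l _ ->.
Qed.

End block_diagonalized.

Theorem theorem3p1 (R : realType) (d : measure_display)
    (Omega : measurableType d) (P : probability Omega R) (xi : {RV P >-> R})
    (K : nat) (phi : 'I_K.+1 -> R -> R)
    (V : 'M[R]_K.+1) (D : 'cV[R]_K.+1 -> 'M[R]_K.+1)
    (h Veq : 'cV[R]_K.+1 -> 'cV[R]_K.+1) (Dh' : 'cV[R]_K.+1 -> 'M[R]_K.+1)
    (tau : R) :
  let Pop := galerkin_op xi phi in
  let H := Hplus xi phi in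
  gpc_basis xi phi ->
  propA1 xi phi -> propA2 xi phi V D -> propA3 xi phi ->
  0 < tau ->
  C1_on H h ->
  (forall rho, H rho ->
     [/\ Jac h rho = V *m Dh' rho *m V^T,
         is_diag_mx (Dh' rho)
       & forall i, 0 < Dh' rho i i]) ->
  [/\ (* (i) *)
      forall rho z : R -> R -> 'cV[R]_K.+1,
        C1_on [set p : R * R | 0 < p.1] (uncurry2 rho) ->
        C1_on [set p : R * R | 0 < p.1] (uncurry2 z) ->
        (forall t x : R, 0 < t -> H (rho t x)) ->
        solves_conservative Pop h Veq tau rho z <->
        solves_nonconservative Pop h Veq tau rho
          (fun t x => velocity Pop h (rho t x) (z t x)),
      (* (ii) *)
      forall rho z : 'cV[R]_K.+1, H rho ->
        let lambda1 := D (velocity Pop h rho z) - Dh' rho *m D rho in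
        let lambda2 := D (velocity Pop h rho z) in
        [/\ differentiable (flux Pop h) (col_mx rho z),
            is_diag_mx lambda1, is_diag_mx lambda2
          & eigenvalues_with_mult (Jac (flux Pop h) (col_mx rho z))
              [seq real_complex R l
                 | l <- diag_entries lambda1 ++ diag_entries lambda2]]
    & (* (iii) *)
      forall rho z : 'cV[R]_K.+1, H rho ->
        strongly_hyperbolic (Jac (flux Pop h) (col_mx rho z))].

Proof.
move=> Pop H _ _ [VV DP] Pop_comm _ h_C1 h_Jac.
have uH a : H a -> Pop a \in unitmx := @pos_def_unitmx R K.+1 (Pop a).
have dh a : H a -> differentiable h a by move=> /h_C1[].
have PopC := galerkin_prodC xi phi.
(* One diagonalization yields both the characteristic speeds and the complete set of
   eigenvectors. *)
have diagonalization rho z (Hrho : H rho) :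
    let v := velocity Pop h rho z in
    [/\ is_diag_mx (D v - Dh' rho *m D rho), is_diag_mx (D v) &
    exists2 U, U \in unitmx & Jac (flux Pop h) (col_mx rho z) *m U =
      U *m block_mx (D v - Dh' rho *m D rho) 0 0 (D v)].
  have [hG dDh posDh] := h_Jac _ Hrho.
  have dD a : is_diag_mx (D a) by have [] := DP a.
  split => //.
    move: (dD (velocity Pop h rho z)) dDh (dD rho).
    move=> /diag_mxP[a ->] /diag_mxP[b ->] /diag_mxP[c ->].
    by rewrite mulmx_diag -linearB diag_mx_is_diag.
  exact: (Jac_flux_diagonalization (Pop := galerkin_op xi phi) PopC Pop_comm z
    VV DP (uH _ Hrho) (dh _ Hrho) hG dDh (diag_mx_unitmx dDh posDh)).
split.
- move=> rho z rho_C1 z_C1 Hrho.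
  have drho p (p0 : 0 < p.1) := (rho_C1 p p0).1.
  have dz p (p0 : 0 < p.1) := (z_C1 p p0).1.
  exact: (conservative_nonconservative_equiv (Pop := galerkin_op xi phi)
    PopC Pop_comm Veq tau uH dh drho dz Hrho).
- move=> rho z Hrho; have [d1 d2 [U uU JU]] := diagonalization rho z Hrho.
  split => //.
    apply: (differentiable_flux (Pop := galerkin_op xi phi)) => //;
      [exact: uH|exact: dh].
  exact: eigenvalues_with_mult_block JU.
- move=> rho z Hrho; have [d1 d2 [U uU JU]] := diagonalization rho z Hrho.
  exact: strongly_hyperbolic_block JU.
Qed.
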